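(* Let $f=\frac1n\sum_{i=1}^n f_i$ where each $f_i:\mathbb{R}^d\to\mathbb{R}$ is differentiable, lower bounded, convex and $L_i$-smooth ($L_i>0$), and set $L_{\max}=\max_{i\in[n]}L_i$. Suppose that $f$ is $\mu$-strongly convex ($\mu>0$), with minimizer $x^*$. Let $0\le\rho\le\frac{1}{L_{\max}}$, let $\gamma_b>0$, and let $\alpha=(1-L_{\max}\rho)^2\min\left\{\frac{1}{2L_{\max}},\gamma_b\right\}$. Let $(x^t)_{t\ge0}$ be the iterates of stochastic USAM with constant radius $\rho_t=\rho$ and the Stochastic Polyak Scheduler with cap $\gamma_b$ (defined in the context), started at $x^0\in\mathbb{R}^d$. Then for all $t\ge0$, $$\mathbb{E}\|x^t-x^*\|^2\le\left(1-\frac{\mu\alpha}{2}\right)^t\|x^0-x^*\|^2+\frac{2(2\gamma_b-\alpha)}{\mu\alpha}\,\sigma^2,$$ where $\sigma^2=\mathbb{E}_{S_t}\left[f_{S_t}(x^* )-\ell_{S_t}^*\right]$.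
   Context: $\|\cdot\|$ is the Euclidean norm; $g$ is $L$-smooth if $\|\nabla g(x)-\nabla g(y)\|\le L\|x-y\|$ for all $x,y$; $f$ is $\mu$-strongly convex if $f-\frac\mu2\|\cdot\|^2$ is convex. Fix a mini-batch size $\tau\in\{1,\dots,n\}$. The mini-batches $S_0,S_1,\dots$ are i.i.d., each uniformly distributed over the subsets of $[n]=\{1,\dots,n\}$ of size $\tau$. For $S\subseteq[n]$ with $|S|=\tau$, $f_S=\frac1\tau\sum_{i\in S}f_i$, and $\ell_S^*\in\mathbb{R}$ is a given (deterministic) lower bound of $f_S$, i.e. $\ell_S^*\le f_S(x)$ for all $x$. Stochastic USAM with constant radius $\rho$ and the Stochastic Polyak Scheduler with cap $\gamma_b$: for $t\ge0$, $$e^t=x^t+\rho\nabla f_{S_t}(x^t),\quad \gamma_t=\min\left\{\frac{f_{S_t}(e^t)-\ell_{S_t}^*-\rho\langle\nabla f_{S_t}(e^t),\nabla f_{S_t}(x^t)\rangle}{\|\nabla f_{S_t}(e^t)\|^2},\gamma_b\right\},\quad x^{t+1}=x^t-\gamma_t\nabla f_{S_t}(e^t).$$ Conventions: if $\nabla f_{S_t}(e^t)=0$ the quotient is read as $+\infty$, so $\gamma_t=\gamma_b$ and $x^{t+1}=x^t$. If $\alpha=0$ (i.e. $\rho=1/L_{\max}$) the right-hand side of the bound is read as $+\infty$. Expectation is over $S_0,S_1,\dots$. *)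

(* Defs.v *)
From mathcomp Require Import all_boot all_order all_algebra finmap.
From mathcomp Require Import all_classical all_reals all_analysis.
Set Implicit Arguments.
Unset Strict Implicit.
Unset Printing Implicit Defensive.
Import Order.TTheory GRing.Theory Num.Theory numFieldNormedType.Exports.
Local Open Scope classical_set_scope.
Local Open Scope ring_scope.

Definition dot (R : realType) (d : nat) (u v : 'rV[R]_d) : R :=
  \sum_(i < d) u 0 i * v 0 i.

(* Needed because the library norm `|u| on 'rV[R]_d is the sup norm. *)
Definition l2norm (R : realType) (d : nat) (u : 'rV[R]_d) : R :=
  Num.sqrt (dot u u).

Definition grad (R : realType) (d : nat) (g : 'rV[R]_d -> R) (x : 'rV[R]_d) :
    'rV[R]_d :=
  \row_(i < d) 'D_(delta_mx 0 i) g x.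

(* Only the Lipschitz condition; differentiability is assumed separately. *)
Definition smooth (R : realType) (d : nat) (L : R) (g : 'rV[R]_d -> R) : Prop :=
  forall x y : 'rV[R]_d, l2norm (grad g x - grad g y) <= L * l2norm (x - y).

Definition convex (R : realType) (d : nat) (g : 'rV[R]_d -> R) : Prop :=
  convex_function [set: convex_lmodType 'rV[R]_d] g.

Definition strongly_convex (R : realType) (d : nat) (mu : R)
    (g : 'rV[R]_d -> R) : Prop :=
  convex (fun x => g x - mu / 2 * l2norm x ^+ 2).

Definition lower_bounded (R : realType) (d : nat) (g : 'rV[R]_d -> R) : Prop :=
  has_lbound (range g).

Definition minimizer (R : realType) (d : nat) (g : 'rV[R]_d -> R)
    (x : 'rV[R]_d) : Prop :=
  forall y, g x <= g y.

Definition objective (R : realType) (d n : nat) (f : 'I_n -> 'rV[R]_d -> R)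
    (x : 'rV[R]_d) : R :=
  n%:R^-1 * \sum_(i < n) f i x.

(* Meant for #|S| = tau. *)
Definition batch (R : realType) (d n tau : nat) (f : 'I_n -> 'rV[R]_d -> R)
    (S : {set 'I_n}) (x : 'rV[R]_d) : R :=
  tau%:R^-1 * \sum_(i in S) f i x.

(* The starting value 0 is harmless when n > 0 and every L i is positive. *)
Definition Lmax (R : realType) (n : nat) (L : 'I_n -> R) : R :=
  \big[Num.max/0]_(i < n) L i.

Definition usam_point (R : realType) (d : nat) (rho : R) (g : 'rV[R]_d -> R)
    (x : 'rV[R]_d) : 'rV[R]_d :=
  x + rho *: grad g x.

(* The quotient is read as +oo when the gradient at the perturbed point
   vanishes, whence the first branch. *)
Definition polyak_step (R : realType) (d : nat) (rho gammab : R)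
    (g : 'rV[R]_d -> R) (l : R) (x : 'rV[R]_d) : R :=
  let e := usam_point rho g x in
  if grad g e == 0 then gammab
  else Num.min
         ((g e - l - rho * dot (grad g e) (grad g x)) / l2norm (grad g e) ^+ 2)
         gammab.

Fixpoint usam_sps (R : realType) (d n tau : nat) (f : 'I_n -> 'rV[R]_d -> R)
    (ell : {set 'I_n} -> R) (rho gammab : R) (x0 : 'rV[R]_d)
    (S : nat -> {set 'I_n}) (t : nat) : 'rV[R]_d :=
  if t is s.+1 then
    let x := usam_sps tau f ell rho gammab x0 S s in
    let g := batch tau f (S s) in
    x - polyak_step rho gammab g (ell (S s)) x *: grad g (usam_point rho g x)
  else x0.

(* The finite type {set 'I_n} carries the discrete sigma-algebra. *)
Definition batch_measurable (dsp : measure_display) (Omega : measurableType dsp)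
    (n : nat) (S : Omega -> {set 'I_n}) : Prop :=
  forall B : set {set 'I_n}, measurable (S @^-1` B).

Definition uniform_batch (R : realType) (dsp : measure_display)
    (Omega : measurableType dsp) (P : probability Omega R) (n tau : nat)
    (S : Omega -> {set 'I_n}) : Prop :=
  forall A : {set 'I_n},
    P (S @^-1` [set A]) = (if #|A| == tau then ('C(n, tau)%:R)^-1 else 0)%:E.

Definition batches_independent (R : realType) (dsp : measure_display)
    (Omega : measurableType dsp) (P : probability Omega R) (n : nat)
    (S : nat -> Omega -> {set 'I_n}) : Prop :=
  forall (J : {fset nat}) (B : nat -> set {set 'I_n}),
    P (\bigcap_(j in [set` J]) (S j @^-1` B j))
    = (\prod_(j <- J) P (S j @^-1` B j))%E.

(* Main.v *)
(** Write [g = f_S], [u = grad g x], [e = x + rho u], [v = grad g e],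
    [a = L rho] and [N = g e - l - rho <v, u>], the numerator of the Polyak
    quotient. Cocoercivity of the gradient gives both
    [N >= (1 - a^2) (g x - l)] and [(1 + a) 2 L N >= (1 - a) |v|^2]; hence the
    step [gamma] satisfies [gamma N >= alpha (g x - l)] and
    [gamma^2 |v|^2 <= gamma N]. Convexity at [e] bounds [<v, x - xs>] from below
    by [N - (g xs - l)], so one step satisfies
    [|x' - xs|^2 <= |x - xs|^2 - alpha (g x - g xs) + (2 gammab - alpha) (g xs - l)].
    Averaging over the mini-batch, which is independent of [x], turns
    [g x - g xs] into [f x - f xs >= mu / 2 |x - xs|^2], and the resulting affine
    recursion is iterated. *)
Require Import Defs.
From mathcomp Require Import all_boot all_order all_algebra finmap.
From mathcomp Require Import all_classical all_reals all_analysis measurable_realfun.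
From mathcomp Require Import lra ring.
Set Implicit Arguments.
Unset Strict Implicit.
Unset Printing Implicit Defensive.
Import Order.TTheory GRing.Theory Num.Theory numFieldNormedType.Exports.
Local Open Scope ring_scope.
Local Open Scope classical_set_scope.

(** * The Euclidean inner product *)

Section dot.
Context {R : realType} {d : nat}.
Implicit Types u v w : 'rV[R]_d.

Lemma dotC u v : dot u v = dot v u.
Proof. by apply: eq_bigr => i _; rewrite mulrC. Qed.

Lemma dotDl u v w : dot (u + v) w = dot u w + dot v w.
Proof. by rewrite -big_split; apply: eq_bigr => i _; rewrite mxE mulrDl. Qed.

Lemma dotZl a u v : dot (a *: u) v = a * dot u v.
Proof. by rewrite /dot mulr_sumr; apply: eq_bigr => i _; rewrite mxE mulrA. Qed.

Lemma dotNl u v : dot (- u) v = - dot u v.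
Proof. by rewrite -scaleN1r dotZl mulN1r. Qed.

Lemma dotDr u v w : dot u (v + w) = dot u v + dot u w.
Proof. by rewrite !(dotC u) dotDl. Qed.

Lemma dotZr a u v : dot u (a *: v) = a * dot u v.
Proof. by rewrite !(dotC u) dotZl. Qed.

Lemma dotNr u v : dot u (- v) = - dot u v.
Proof. by rewrite !(dotC u) dotNl. Qed.

Definition dotE := (dotDl, dotDr, dotNl, dotNr, dotZl, dotZr).

Lemma dot_ge0 u : 0 <= dot u u.
Proof. by apply: sumr_ge0 => i _; exact: sqr_ge0. Qed.

Lemma dot_eq0 u : (dot u u == 0) = (u == 0).
Proof.
apply/idP/eqP => [|->]; last by rewrite /dot big1// => i _; rewrite mxE mul0r.
rewrite psumr_eq0 => [/allP h|i _]; last exact: sqr_ge0.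
apply/rowP => i; have := h i; rewrite mem_index_enum => /(_ isT).
by rewrite mxE mulf_eq0 orbb => /eqP.
Qed.

Lemma l2norm_sqr u : l2norm u ^+ 2 = dot u u.
Proof. exact/sqr_sqrtr/dot_ge0. Qed.

Lemma l2norm_leP u v a : 0 <= a ->
  l2norm u <= a * l2norm v -> dot u u <= a ^+ 2 * dot v v.
Proof.
move=> a0 h; rewrite -!l2norm_sqr -exprMn.
by rewrite lerXn2r// nnegrE ?mulr_ge0 ?sqrtr_ge0.
Qed.

(** Expansion of [|u - a v|^2 >= 0]. The sign of [a] is free; a negative value is used below. *)
Lemma dot_AMGM a u v : 2 * a * dot u v <= dot u u + a ^+ 2 * dot v v.
Proof. by have := dot_ge0 (u - a *: v); rewrite !dotE (dotC v u); lra. Qed.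

End dot.

(** * First-order convexity and the descent lemma *)

Section linear_quadratic_bounds.
Context {R : realType} {d : nat}.
Implicit Types (g : 'rV[R]_d -> R) (x y v : 'rV[R]_d).

Lemma convex_line g x y (t : R) : convex g -> 0 <= t <= 1 ->
  g (t *: y + (1 - t) *: x) <= t * g y + (1 - t) * g x.
Proof.
move=> cg t01; have := cg (Itv01 (andP t01).1 (andP t01).2) y x.
by rewrite !inE => /(_ I I).
Qed.

Lemma derive_grad g x v : differentiable g x -> 'D_v g x = dot (grad g x) v.
Proof.
move=> dg; rewrite deriveE// {1}(row_sum_delta v) linear_sum.
by apply: eq_bigr => i _; rewrite linearZ/= mxE mulrC deriveE.
Qed.

(** Convexity on the segment bounds every right difference quotient along [y - x] by [g y - g x],
    and the bound passes to the limit. *)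
Lemma convex_first_order g x y : differentiable g x -> convex g ->
  g x + dot (grad g x) (y - x) <= g y.
Proof.
move=> dg cg; rewrite -lerBrDl -derive_grad//.
have /= dxy := @diff_derivable _ _ _ _ _ (y - x) dg.
rewrite /derive cvg_at_rightE//; apply: limr_le.
  by apply/cvg_ex; eexists; exact: cvg_dnbhs_at_right dxy.
near=> t.
have t0 : 0 < t by near: t; exact: nbhs_right_gt.
have t1 : t <= 1 by near: t; exact: nbhs_right_le.
rewrite /= /GRing.scale/= ler_pdivrMl//.
have := convex_line x y cg (t := t); rewrite (ltW t0) t1 => /(_ isT).
rewrite (_ : t *: y + _ = t *: (y - x) + x); last first.
  by rewrite scalerBr scalerBl scale1r addrA addrAC.
lra.
Unshelve. all: by end_near. Qed.

Lemma is_derive_line g x v (t : R) : differentiable g (x + t *: v) ->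
  is_derive t 1 (fun s => g (x + s *: v)) (dot (grad g (x + t *: v)) v).
Proof.
move=> dg; rewrite -derive_grad//.
(* Both difference quotients are the same function of [h], so derivability and the value of the
   derivative transfer together. *)
have e : (fun h : R => h^-1 *: (((fun s => g (x + s *: v)) \o shift t) (h *: 1)
             - g (x + t *: v))) =
         (fun h : R => h^-1 *: ((g \o shift (x + t *: v)) (h *: v)
             - g (x + t *: v))).
  apply/funext => h /=; congr (_ *: (g _ - _)).
  by rewrite [h *: 1]mulr1 scalerDl addrCA.
split; last by rewrite /derive e.
by rewrite /derivable e; exact: diff_derivable.
Qed.

(* The derivative of [h] at [t > 0] is
   [<grad g (x + t v) - grad g x, v> - L t |v|^2 <= 0]. *)
Lemma smooth_descent g (L : R) x y : 0 < L -> (forall z, differentiable g z) ->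
  smooth L g ->
  g y <= g x + dot (grad g x) (y - x) + L / 2 * dot (y - x) (y - x).
Proof.
move=> L0 dg sg; set v := y - x.
pose h (t : R) := g (x + t *: v) - t * dot (grad g x) v
  - L / 2 * dot v v * t ^+ 2.
pose dh (t : R) := dot (grad g (x + t *: v)) v - dot (grad g x) v
  - L * dot v v * t.
have hd (t : R) : is_derive t 1 h (dh t).
  have := is_derive_line (dg (x + t *: v)) => dgt.
  apply: is_derive_eq; rewrite /dh /GRing.scale/=; lra.
have hc : {within `[0, 1], continuous h}.
  by apply: derivable_within_continuous => t _; have [] := hd t.
have [t t01] := MVT ltr01 (fun t _ => hd t) hc.
rewrite /h scale1r scale0r addr0 {1}/v addrCA subrr addr0.
suff : dh t <= 0 by lra.
have t0 : 0 < t by move: t01; rewrite in_itv => /andP[].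
have := l2norm_leP (ltW L0) (sg (x + t *: v) x).
rewrite /dh addrAC subrr add0r dotZl dotZr.
rewrite (_ : dot (grad g _) v - _ = dot (grad g (x + t *: v) - grad g x) v).
  move: (_ - grad g x) => p hp.
  have := dot_AMGM (L * t) p v.
  have Lt0 : 0 < L * t by rewrite mulr_gt0.
  rewrite subr_le0 -(ler_pM2l Lt0); lra.
by rewrite dotDl dotNl.
Qed.

(** * Mini-batch averages and growth around a minimizer *)

Lemma is_derive_bigsum (I : Type) (r : seq I) (Q : pred I)
    (f : I -> 'rV[R]_d -> R) x v :
  (forall i, differentiable (f i) x) ->
  is_derive x v (fun y => \sum_(i <- r | Q i) f i y)
    (\sum_(i <- r | Q i) 'D_v (f i) x).
Proof.
move=> df; elim: r => [|i r ih].
  under eq_fun do rewrite big_nil; rewrite big_nil; exact: is_derive_cst.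
under eq_fun do rewrite big_cons; rewrite big_cons; case: ifP => // _.
by apply: is_deriveD => //; apply/derivableP/diff_derivable.
Qed.

Lemma grad_batch n tau (f : 'I_n -> 'rV[R]_d -> R) (S : {set 'I_n}) x :
  (forall i, differentiable (f i) x) ->
  grad (batch tau f S) x = tau%:R^-1 *: \sum_(i in S) grad (f i) x.
Proof.
move=> df; apply/rowP => i; rewrite !mxE summxE.
under eq_bigr do rewrite mxE.
have h := is_derive_bigsum (index_enum _) (mem S) (delta_mx 0 i) df.
by have [_] := is_deriveZ (tau%:R^-1) h.
Qed.

(** Convexity and [L]-smoothness in first-order form. Being linear in [g], the two bounds are
    inherited by averages, and the one-step analysis rests on them alone. *)
Definition quad_bounded (L : R) g := forall x y,
  g x + dot (grad g x) (y - x) <= g y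
    <= g x + dot (grad g x) (y - x) + L / 2 * dot (y - x) (y - x).

Lemma dot_suml (I : Type) (r : seq I) (Q : pred I) (F : I -> 'rV[R]_d) v :
  dot (\sum_(i <- r | Q i) F i) v = \sum_(i <- r | Q i) dot (F i) v.
Proof.
apply: (big_morph (fun u => dot u v)) => [u w|]; first exact: dotDl.
by rewrite /dot big1// => i _; rewrite mxE mul0r.
Qed.

Lemma quad_bounded_batch n tau (f : 'I_n -> 'rV[R]_d -> R) (S : {set 'I_n}) L :
  (0 < tau)%N -> #|S| = tau -> (forall i x, differentiable (f i) x) ->
  (forall i, quad_bounded L (f i)) -> quad_bounded L (batch tau f S).
Proof.
move=> tau0 cS df qf x y; rewrite grad_batch// dotZl dot_suml /batch -mulrDr.
have tau0' : 0 < tau%:R^-1 :> R by rewrite invr_gt0 ltr0n.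
rewrite ler_pM2l// -big_split/= ler_sum/=; last first.
  by move=> i _; have /andP[] := qf i x y.
(* The quadratic term is written as an average of [tau] equal copies, which [#|S| = tau] turns into
   a sum over [S]. *)
rewrite -[X in _ <= _ + X](mulVKf (lt0r_neq0 tau0')) invrK -mulrDr ler_pM2l//.
rewrite mulr_natl -cS -sumr_const -big_split/= ler_sum//=.
by move=> i _; have /andP[] := qf i x y.
Qed.

Lemma objective_batch n (f : 'I_n -> 'rV[R]_d -> R) :
  objective f = batch n f [set: 'I_n]%SET.
Proof.
apply/funext => x; rewrite /objective /batch; congr (_ * _).
by apply: eq_bigl => i; rewrite inE.
Qed.

(** Strong convexity on the segment from [xs] to [x], with minimality of [xs] at its points, gives
    [key]; the conclusion is its limit as [t] tends to 0. *)
Lemma strongly_convex_growth (mu : R) g xs x : strongly_convex mu g ->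
  minimizer g xs -> mu / 2 * dot (x - xs) (x - xs) <= g x - g xs.
Proof.
move=> sc mg; set D := dot _ _; set c := g x - g xs.
have key t : 0 < t < 1 -> (1 - t) * (mu / 2 * D) <= c.
  move=> /andP[t0 t1]; have := convex_line xs x sc (t := t).
  rewrite (ltW t0) (ltW t1) => /(_ isT); rewrite !l2norm_sqr.
  have := mg (t *: x + (1 - t) *: xs); rewrite -(ler_pM2l t0 ((1 - t) * _)) /c.
  move: (g (_ + _)) => z; rewrite /D !dotE (dotC xs x); lra.
rewrite leNgt; apply/negP => cD.
have c0 : 0 <= c by rewrite subr_ge0.
have D0 : 0 < mu / 2 * D by exact: le_lt_trans cD.
(* An explicit [t] replaces the limit: here [(1 - t) E = (E + c) / 2], which exceeds [c] when
   [c < E]. *)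
pose t := (mu / 2 * D - c) / (mu / 2 * D) / 2.
have := key t; rewrite /t; set E := mu / 2 * D in cD D0 *.
have -> : (1 - (E - c) / E / 2) * E = E / 2 + c / 2 by field; rewrite lt0r_neq0.
have h : 0 < (E - c) / E <= 1.
  by rewrite divr_gt0 ?subr_gt0// ler_pdivrMr// mul1r gerBl.
lra.
Qed.

(** Adding the upper bounds at [x] and at its reflection through [xs] cancels the gradient at
    [xs]. *)
Lemma growth_le_smooth (mu L : R) g xs x : quad_bounded L g ->
  (forall y, mu / 2 * dot (y - xs) (y - xs) <= g y - g xs) ->
  mu * dot (x - xs) (x - xs) <= L * dot (x - xs) (x - xs).
Proof.
move=> qg h.
have /andP[_] := qg xs x; have /andP[_] := qg xs (xs - (x - xs)).
have := h x; have := h (xs - (x - xs)).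
have -> : xs - (x - xs) - xs = - (x - xs) by rewrite addrAC subrr add0r.
by rewrite !dotNr !dotNl opprK; lra.
Qed.

(** * One step of the Polyak scheduler *)

Section quad_bounded_theory.
Context (L : R) (g : 'rV[R]_d -> R) (L0 : 0 < L) (qg : quad_bounded L g).

Let L_neq0 : L != 0. Proof. exact: lt0r_neq0. Qed.

(** The point [x - grad g x / L] minimizes the quadratic upper bound at [x], and [l] lies below the
    value of [g] there. *)
Lemma quad_bounded_gap l x : (forall y, l <= g y) ->
  dot (grad g x) (grad g x) / (2 * L) <= g x - l.
Proof.
move=> lg; have /andP[_] := qg x (x - L^-1 *: grad g x).
have := lg (x - L^-1 *: grad g x); move: (g (_ - _)) => z.
have -> : x - L^-1 *: grad g x - x = - (L^-1 *: grad g x).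
  by rewrite addrAC subrr add0r.
rewrite !dotNr !dotNl opprK !dotZr !dotZl; set U := dot _ _.
have -> : L / 2 * (L^-1 * (L^-1 * U)) = U / (2 * L) by field.
have -> : - (L^-1 * U) = - 2 * (U / (2 * L)) by field.
lra.
Qed.

(* Compare the bounds from [x] and from [y] at [y - (grad g y - grad g x) / L]. *)
Lemma quad_bounded_cocoercive x y :
  g x + dot (grad g x) (y - x)
    + dot (grad g x - grad g y) (grad g x - grad g y) / (2 * L) <= g y.
Proof.
set u := grad g x; set v := grad g y.
pose z := y - L^-1 *: (v - u).
have /andP[_] := qg y z; have /andP[+ _] := qg x z.
have -> : z - y = L^-1 *: (u - v).
  by rewrite /z addrAC subrr add0r -scalerN opprB.
have -> : z - x = y - x + L^-1 *: (u - v).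
  by rewrite /z addrAC -scalerN opprB.
rewrite -/u -/v; set gz := g z.
rewrite (dotDr u) !dotZr !dotZl.
set W := dot (u - v) (u - v).
have WE : dot u (u - v) - dot v (u - v) = W by rewrite -dotNl -dotDl.
have -> : L / 2 * (L^-1 * (L^-1 * W)) = W / (2 * L) by field.
have : L^-1 * dot u (u - v) = 2 * (W / (2 * L)) + L^-1 * dot v (u - v).
  by rewrite -WE; field.
lra.
Qed.

Section step.
Context (rho l gammab : R) (xs x : 'rV[R]_d).
Hypotheses (rho0 : 0 <= rho) (rhoL : L * rho <= 1) (gammab0 : 0 < gammab).
Hypothesis lg : forall y, l <= g y.

Let a := L * rho.
Let alpha := (1 - a) ^+ 2 * Num.min (1 / (2 * L)) gammab.
Let e := usam_point rho g x.
Let u := grad g x.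
Let v := grad g e.
(** The products of [u] and [v] are all linear in [U], [W] and [p], which reduces the estimates on
    [N] and [V] to scalar arithmetic. *)
Let U := dot u u.
Let W := dot (u - v) (u - v).
Let p := dot u (u - v).
Let N := g e - l - rho * dot v u.
Let V := dot v v.

Let L2 : 0 < 2 * L. Proof. by rewrite mulr_gt0. Qed.

Let subE : e - x = rho *: u.
Proof. by rewrite /e /usam_point addrAC subrr add0r. Qed.

Let vu : dot v u = U - p.
Proof. by rewrite /p !dotE (dotC v u) subKr. Qed.

Let VE : V = U - 2 * p + W.
Proof. by rewrite /V /U /p /W !dotE (dotC v u); lra. Qed.

Let a01 : 0 <= a <= 1. Proof. by rewrite mulr_ge0 // ltW. Qed.

(** Cocoercivity used in both directions between [x] and [e] gives [W <= - a p]; the inequality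
    [- 2 a p <= W + a^2 U] then absorbs one [W]. *)
Let WaU : W <= a ^+ 2 * U.
Proof.
have := quad_bounded_cocoercive x e; have := quad_bounded_cocoercive e x.
rewrite -opprB subE -/u -/v.
have -> : dot (v - u) (v - u) = W by rewrite -opprB !dotE /W !dotE; lra.
rewrite -/W dotNr !dotZr vu -/U => h1 h2.
have : - (a * p) >= W.
  have : W / (2 * L) + W / (2 * L) <= - (rho * p) by lra.
  have -> : W / (2 * L) + W / (2 * L) = W / L by field.
  by rewrite ler_pdivrMr// /a; lra.
by have := dot_AMGM (- a) (u - v) u; rewrite dotC -/W -/p -/U; lra.
Qed.

Let pge : - (a ^+ 2 * U + W) <= 2 * a * p.
Proof.
by have := dot_AMGM (- a) (u - v) u; rewrite dotC -/W -/p -/U; lra.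
Qed.

Let Nge : (g x - l) * (2 * L) + 2 * a * p + W <= N * (2 * L).
Proof.
have := quad_bounded_cocoercive x e; rewrite subE -/u -/v dotZr -/U -/W.
rewrite -(ler_pM2r L2) mulrDl divfK ?lt0r_neq0// /N vu /a; lra.
Qed.

Let gap : U <= (g x - l) * (2 * L).
Proof.
by have := quad_bounded_gap x lg; rewrite -/u -/U ler_pdivrMr.
Qed.

(* The two bounds on the numerator of the Polyak quotient multiply to give
   [(1 - a)^2], because [(1 - a) / (1 + a) * (1 - a^2) = (1 - a)^2]. *)
Lemma polyak_numerator_gap : (1 - a ^+ 2) * (g x - l) <= N.
Proof.
rewrite -(ler_pM2r L2).
have := ler_wpM2l (sqr_ge0 a) gap; have := pge; have := Nge; lra.
Qed.

Lemma polyak_numerator_grad : (1 - a) * V <= (1 + a) * (N * (2 * L)).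
Proof.
have N1 : U + 2 * a * p + W <= N * (2 * L).
  by have := Nge; have := gap; lra.
(* The right-hand side equals [(1 + a) (U + 2 a p + W) - (1 - a) V]. *)
suff : 0 <= 2 * a * (U + W) + 2 * p * (1 + a ^+ 2).
  have a1 : 0 <= 1 + a by rewrite addr_ge0//; have /andP[] := a01.
  have := ler_wpM2l a1 N1; rewrite VE; lra.
have U0 : 0 <= U := dot_ge0 u; have W0 : 0 <= W := dot_ge0 (u - v).
(* The main argument multiplies the claim by [a]. When [a = 0], [WaU] forces [u = v], hence
   [p = 0]. *)
have [a0|a0] := eqVneq a 0.
  have W00 : u - v = 0.
    apply/eqP; rewrite -dot_eq0 eq_le dot_ge0 andbT.
    by have := WaU; rewrite a0 expr0n/= mul0r.
  by rewrite /p W00 a0 dotC /dot big1 => [|i _]; rewrite ?mxE ?mul0r; lra.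
have ap : 0 < a by rewrite lt_neqAle eq_sym a0; have /andP[] := a01.
rewrite -(pmulr_rge0 _ ap).
(* After multiplication by [a], [pge] bounds the claim from below by exactly twice-free remainder
   [(1 - a^2) (a^2 U - W)], nonnegative by [WaU]. *)
have : 0 <= (1 - a ^+ 2) * (a ^+ 2 * U - W).
  by rewrite mulr_ge0// ?subr_ge0// expr_le1//; have /andP[] := a01.
have : 0 <= 1 + a ^+ 2 by rewrite addr_ge0 ?sqr_ge0.
move=> /ler_wpM2r/(_ _ _ pge); lra.
Qed.

Let gamma := polyak_step rho gammab g l x.

Let L2i : 0 < 1 / (2 * L). Proof. exact: divr_gt0. Qed.

Let G0 : 0 <= g x - l. Proof. by rewrite subr_ge0. Qed.

Let N0 : 0 <= N.
Proof.
apply: le_trans polyak_numerator_gap; rewrite mulr_ge0// subr_ge0 expr_le1//.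
by have /andP[] := a01.
Qed.

Let aa : (1 - a) ^+ 2 <= 1 - a ^+ 2.
Proof. by have /andP[a0 a1] := a01; nra. Qed.

Let capped : alpha * (g x - l) <= gammab * N.
Proof.
apply: (@le_trans _ _ (gammab * ((1 - a ^+ 2) * (g x - l)))).
  rewrite mulrA ler_wpM2r// mulrC ler_pM ?sqr_ge0//.
  - by rewrite le_min (ltW L2i) (ltW gammab0).
  - by rewrite ge_min lexx orbT.
by rewrite ler_pM2l// polyak_numerator_gap.
Qed.

Let uncapped : 0 < V -> alpha * (g x - l) <= N / V * N.
Proof.
move=> V0.
apply: (@le_trans _ _ ((1 - a) ^+ 2 * (1 / (2 * L)) * (g x - l))).
  by rewrite ler_wpM2r// ler_wpM2l ?sqr_ge0// ge_min lexx.
have /andP[a0 _] := a01; have a1 : 0 <= 1 - a by rewrite subr_ge0.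
have a2 : 0 < 1 + a by rewrite (lt_le_trans ltr01)// lerDl.
rewrite [leRHS]mulrAC ler_pdivlMr//.
have -> : (1 - a) ^+ 2 * (1 / (2 * L)) * (g x - l) * V =
  (1 - a) ^+ 2 * (g x - l) * V / (2 * L) by field.
(* The factor [1 + a] is multiplied in so that [(1 + a) 2 L N^2 >= (1 - a) V N >= (1 - a) (1 - a^2)
   V (g x - l)] closes the goal. *)
rewrite ler_pdivrMr// -(ler_pM2l a2).
have h1 := ler_wpM2r N0 polyak_numerator_grad.
have h2 := ler_wpM2l (mulr_ge0 a1 (ltW V0)) polyak_numerator_gap.
lra.
Qed.

(** The third bound comes from [gamma V <= N], an equality when the quotient is taken, strict when
    the cap is active; for a vanishing gradient [V = 0]. *)
Let polyak_stepP :
  [/\ 0 <= gamma, gamma <= gammab, gamma ^+ 2 * V <= gamma * N &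
      alpha * (g x - l) <= gamma * N].
Proof.
rewrite /gamma /polyak_step -/e -/v l2norm_sqr -/V -/N.
have [v0|v0] := ifPn.
  have V0 : V = 0 by apply/eqP; rewrite dot_eq0.
  by split; rewrite ?V0 ?mulr0 ?mulr_ge0// ltW.
have V0 : 0 < V by rewrite lt_neqAle eq_sym dot_eq0 v0 dot_ge0.
have NV0 : 0 <= N / V by rewrite divr_ge0// ltW.
have [h|h] := leP (N / V) gammab; split => //.
- by rewrite expr2 -mulrA divfK ?gt_eqF.
- exact: uncapped.
- exact: ltW.
- by rewrite expr2 -mulrA ler_pM2l// -ler_pdivlMr// ltW.
Qed.

(** With [delta = g xs - l], expanding the square gives at most [- 2 gamma (N - delta) + gamma N = -
    gamma N + 2 gamma delta] beyond [|x - xs|^2]. Splitting [g x - l] as [(g x - g xs) + delta]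
    produces the factor [2 gammab - alpha]. *)
Lemma usam_polyak_descent :
  l2norm (x - gamma *: v - xs) ^+ 2 <=
  l2norm (x - xs) ^+ 2 - alpha * (g x - g xs) + (2 * gammab - alpha) * (g xs - l).
Proof.
have [g0 g1 g2 g3] := polyak_stepP.
have /andP[+ _] := qg e xs; rewrite -/v => h.
have hx : N - (g xs - l) <= dot v (x - xs).
  rewrite (_ : x - xs = - (xs - e) - rho *: u).
    by rewrite dotDr !dotNr dotZr /N; lra.
  by rewrite opprB -subE opprB [RHS]addrC subrKA.
rewrite !l2norm_sqr addrAC; move: (x - xs) hx => z hx.
rewrite dotDl !dotDr !dotNl !dotNr !dotZl !dotZr opprK (dotC z v) -/V.
have gl : 0 <= g xs - l by rewrite subr_ge0.
have := ler_wpM2l g0 hx; have := ler_wpM2r gl g1; lra.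
Qed.

End step.
End quad_bounded_theory.
End linear_quadratic_bounds.

(** * Expectations over finitely valued independent draws *)

Section finite_draws.
Context {R : realType} {dsp : measure_display} {Omega : measurableType dsp}.
Context (P : probability Omega R).

Lemma measurable_preimage (f : Omega -> R) :
  (forall Y : set R, measurable (f @^-1` Y)) -> measurable_fun setT (EFin \o f).
Proof.
by move=> mf; apply/measurable_EFinP => _ Y _; rewrite setTI; exact: mf.
Qed.

Section split.
Context {T : finType} (X : Omega -> T).
Hypothesis mX : forall B : set T, measurable (X @^-1` B).

Lemma integral_split_finite (D : set Omega) (f : Omega -> R) :
  measurable D -> measurable_fun setT (EFin \o f) ->
  (\int[P]_(w in D) (f w)%:E =
   \sum_A \int[P]_(w in D `&` X @^-1` [set A]) (f w)%:E)%E.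
Proof.
move=> mD mf.
have -> : (\int[P]_(w in D) (f w)%:E = \int[P]_(w in
    \big[setU/set0]_(A <- index_enum T) (D `&` X @^-1` [set A])) (f w)%:E)%E.
  congr (integral _ _ _); rewrite -bigcup_seq; apply/seteqP; split => w.
    by move=> Dw; exists (X w) => //=; rewrite mem_index_enum.
  by move=> [A _ []].
rewrite integral_bigsetU_EFin//.
- by move=> A; exact: measurableI.
- exact: index_enum_uniq.
- by move=> A B _ _ [w [[_ <-] [_ <-]]].
- exact: measurable_funTS.
Qed.

Lemma expectation_finite (c : T -> R) :
  ('E_P[(fun w => c (X w))] = \sum_A (c A)%:E * P (X @^-1` [set A]))%E.
Proof.
rewrite unlock (integral_split_finite measurableT); last first.
  by apply: measurable_preimage => Y; exact: (mX (c @^-1` Y)).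
apply: eq_bigr => A _; rewrite setTI -integral_cst//.
by apply: eq_integral => w; rewrite inE => ->.
Qed.

End split.

(** * Recursions driven by independent draws *)

Section driven.
Context {T : finType} {V : Type} (S : nat -> Omega -> T) (p : T -> R).
Hypothesis mS : forall t (B : set T), measurable (S t @^-1` B).
Hypothesis lawS : forall t A, P (S t @^-1` [set A]) = (p A)%:E.
Hypothesis indS : forall (J : {fset nat}) (B : nat -> set T),
  P (\bigcap_(j in [set` J]) (S j @^-1` B j))
  = (\prod_(j <- J) P (S j @^-1` B j))%E.
Context (step : T -> V -> V) (x0 : V).

Fixpoint driven (s : nat -> T) (t : nat) : V :=
  if t is k.+1 then step (s k) (driven s k) else x0.

(** The Markov transition operator applied [t] times to [phi] and evaluated at [x0], with no
    reference to [Omega]; [expectation_driven] identifies it with the expectation. *)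
Fixpoint driven_mean (t : nat) (phi : V -> R) : R :=
  if t is k.+1 then driven_mean k (fun x => \sum_A p A * phi (step A x))
  else phi x0.

Lemma driven_mean_sum t (I : finType) (phi : I -> V -> R) (c : I -> R) :
  driven_mean t (fun x => \sum_i c i * phi i x) =
  \sum_i c i * driven_mean t (phi i).
Proof.
elim: t phi => [//|t ih] phi /=.
rewrite -ih; congr driven_mean; apply/funext => x.
under eq_bigr do rewrite mulr_sumr; rewrite exchange_big.
by apply: eq_bigr => i _; rewrite mulr_sumr; apply: eq_bigr => A _; ring.
Qed.

Let X t w := driven (fun k => S k w) t.

(** [V] carries no sigma-algebra: [X t] depends on finitely many draws from a finite type, so
    arbitrary sets [Y] are allowed. *)
Lemma measurable_driven t (Y : set V) : measurable (X t @^-1` Y).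
Proof.
elim: t Y => [|t ih] Y.
  rewrite (_ : X 0 @^-1` Y = if x0 \in Y then setT else set0).
    by case: ifP.
  by apply/seteqP; split => w /=; case: ifPn => [/set_mem|/negP]; rewrite ?inE.
rewrite (_ : _ @^-1` _ =
    \bigcup_(A in [set: T]) (S t @^-1` [set A] `&` X t @^-1` (step A @^-1` Y))).
  by apply: fin_bigcup_measurable => // A _; exact: measurableI.
by apply/seteqP; split => w /=; [exists (S t w)|move=> [A _ [<-]]].
Qed.

(* [S t], on which the step out of time [t] depends, is traded for one more
   constraint on the draws from time [t] on. *)
Lemma integral_driven t (phi : V -> R) (J : {fset nat}) (B : nat -> set T) :
  (forall j, j \in J -> (t <= j)%N) ->
  (\int[P]_(w in \bigcap_(j in [set` J]) (S j @^-1` B j)) (phi (X t w))%:E =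
   (driven_mean t phi)%:E * P (\bigcap_(j in [set` J]) (S j @^-1` B j)))%E.
Proof.
have mE (J' : {fset nat}) (B' : nat -> set T) :
    measurable (\bigcap_(j in [set` J']) (S j @^-1` B' j)).
  by apply: bigcap_measurableType => j _; exact: mS.
elim: t phi J B => [|t ih] phi J B tJ.
  by rewrite -integral_cst.
rewrite (integral_split_finite (mS t)) //; last first.
  by apply: measurable_preimage => Y; exact: (measurable_driven t.+1 (phi @^-1` Y)).
set E := \bigcap_(j in _) _.
have tNJ : t \notin J by apply/negP => /tJ; rewrite ltnn.
have [r rE] : exists r, P E = r%:E.
  by exists (fine (P E)); rewrite fineK// fin_num_measure//; exact: mE.
rewrite /= driven_mean_sum rE -EFinM mulr_suml -sumEFin; apply: eq_bigr => A _.
pose B' j := if j == t then [set A] else B j.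
have BB' j : j \in J -> B' j = B j.
  by move=> jJ; rewrite /B'; case: eqP => // jt; rewrite jt (negbTE tNJ) in jJ.
have EA : E `&` S t @^-1` [set A] =
    \bigcap_(j in [set` (t |` J)%fset]) (S j @^-1` B' j).
  rewrite set_fsetU1 bigcap_setU1 {1}/B' eqxx setIC; congr (_ `&` _).
  by apply: eq_bigcapr => j /= /BB' ->.
have PEA : P (E `&` S t @^-1` [set A]) = (p A * r)%:E.
  rewrite EA indS big_fsetU1//= {1}/B' eqxx lawS EFinM -rE /E indS; congr *%E.
  by apply: eq_big_seq => j /BB' ->.
rewrite (_ : (\int[P]_(w in _) _)%E = (\int[P]_(w in
    E `&` S t @^-1` [set A]) (phi (step A (X t w)))%:E)%E); last first.
  by apply: eq_integral => w; rewrite inE => -[_] /= <-.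
rewrite [in LHS]EA (ih (phi \o step A)) -?EA ?PEA -?EFinM; last first.
  by move=> j; rewrite in_fset1U => /orP[/eqP->//|/tJ/ltnW].
by congr EFin; rewrite mulrA (mulrC (driven_mean _ _)).
Qed.

Lemma expectation_driven t (phi : V -> R) :
  ('E_P[(fun w => phi (X t w))] = (driven_mean t phi)%:E)%E.
Proof.
have := @integral_driven t phi fset0 (fun=> setT) (fun j => ltac:(by rewrite inE)).
rewrite unlock (_ : \bigcap_(j in _) _ = setT); last first.
  by apply/seteqP; split => // w _ j.
by rewrite probability_setT mule1.
Qed.

Lemma driven_mean_le t (phi psi : V -> R) : (forall A, 0 <= p A) ->
  (forall x, phi x <= psi x) -> driven_mean t phi <= driven_mean t psi.
Proof.
move=> p0; elim: t phi psi => [|t ih] phi psi h /=; first exact: h.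
by apply: ih => x; apply: ler_sum => A _; rewrite ler_wpM2l.
Qed.

Lemma driven_mean_affine t (a b : R) (phi : V -> R) : \sum_A p A = 1 ->
  driven_mean t (fun x => a * phi x + b) = a * driven_mean t phi + b.
Proof.
move=> p1; elim: t phi => [//|t ih] phi /=; rewrite -ih.
congr driven_mean; apply/funext => x; rewrite mulr_sumr.
under eq_bigr do rewrite mulrDr mulrCA; rewrite big_split/=.
by rewrite -mulr_suml p1 mul1r.
Qed.

(** The constant [c / (1 - q)] is the fixed point of [r |-> q r + c], so the bound at [t.+1] is
    exactly the image of the bound at [t]. *)
Lemma driven_mean_contract (q c : R) (phi : V -> R) t :
  (forall A, 0 <= p A) -> \sum_A p A = 1 -> 0 <= q < 1 ->
  (forall x, \sum_A p A * phi (step A x) <= q * phi x + c) -> 0 <= c ->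
  driven_mean t phi <= q ^+ t * phi x0 + c / (1 - q).
Proof.
move=> p0 p1 /andP[q0 q1] h c0; have q1' : 0 < 1 - q by rewrite subr_gt0.
elim: t => [|t ih] /=; first by rewrite mul1r lerDl divr_ge0// ltW.
apply: le_trans (driven_mean_le t p0 h) _; rewrite driven_mean_affine//.
have -> : q ^+ t.+1 * phi x0 + c / (1 - q) =
    q * (q ^+ t * phi x0 + c / (1 - q)) + c.
  by rewrite exprS; field; rewrite gt_eqF.
by rewrite lerD2r ler_wpM2l.
Qed.

End driven.
End finite_draws.

(** * Uniform mini-batches *)

Section uniform_batches.
Local Open Scope set_scope.
Context {R : realType} {d n : nat} (tau : nat) (htau : (1 <= tau <= n)%N).

Definition batch_law (A : {set 'I_n}) : R :=
  if #|A| == tau then ('C(n, tau)%:R)^-1 else 0.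

Let C0 : ('C(n, tau)%:R : R) != 0.
Proof. by rewrite pnatr_eq0 -lt0n bin_gt0; case/andP: htau. Qed.

Lemma batch_law_ge0 A : 0 <= batch_law A.
Proof. by rewrite /batch_law; case: ifP. Qed.

Lemma sum_batch_law (F : {set 'I_n} -> R) :
  \sum_A batch_law A * F A =
  'C(n, tau)%:R^-1 * \sum_(A : {set 'I_n} | #|A| == tau) F A.
Proof.
rewrite mulr_sumr [RHS]big_mkcond; apply: eq_bigr => A _.
by rewrite /batch_law; case: ifP => // _; rewrite mul0r.
Qed.

Lemma sum_batch_law1 : \sum_A batch_law A = 1.
Proof.
under eq_bigr do rewrite -[batch_law _]mulr1.
rewrite sum_batch_law sumr_const -cardsE.
by rewrite card_draws card_ord mulVf.
Qed.

(** Pascal's rule: the batches that avoid [i] are the [tau]-subsets of the other [n - 1] indices. *)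
Lemma card_batches_at (i : 'I_n) :
  #|[set A : {set 'I_n} | (#|A| == tau) && (i \in A)]| = 'C(n.-1, tau.-1).
Proof.
have n0 : (0 < n)%N by case: (n) i => // -[].
have h := cardsID [set A : {set 'I_n} | i \in A] [set A : {set 'I_n} | #|A| == tau].
have h1 : [set A : {set 'I_n} | #|A| == tau] :\: [set A : {set 'I_n} | i \in A] =
    [set A : {set 'I_n} | (A \subset [set~ i]) && (#|A| == tau)].
  by apply/setP => A; rewrite !inE finset.subsetC finset.sub1set inE.
have h2 : [set A : {set 'I_n} | #|A| == tau] :&: [set A : {set 'I_n} | i \in A] =
    [set A : {set 'I_n} | (#|A| == tau) && (i \in A)].
  by apply/setP => A; rewrite !inE.
move: h; rewrite h1 h2 cards_draws card_draws cardsC1 card_ord.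
case: tau htau => // k _; have := binS n.-1 k; rewrite prednK// => -> /=.
by rewrite [LHS]addnC => /addnI.
Qed.

(** Each index lies in ['C(n.-1, tau.-1)] batches, and [n 'C(n.-1, tau.-1) = tau 'C(n, tau)]. *)
Lemma mean_batch (f : 'I_n -> 'rV[R]_d -> R) x :
  \sum_A batch_law A * batch tau f A x = objective f x.
Proof.
have /andP[tau0 taun] := htau.
have t0 : (tau%:R : R) != 0 by rewrite pnatr_eq0 -lt0n.
have n0 : (n%:R : R) != 0 by rewrite pnatr_eq0 -lt0n (leq_trans tau0).
rewrite sum_batch_law /batch -mulr_sumr.
rewrite (exchange_big_dep xpredT)//=.
under eq_bigr => i _.
  rewrite sumr_const -cardsE card_batches_at -mulr_natr.
over.
rewrite -mulr_suml /objective.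
have := mul_bin_diag n tau.-1; rewrite prednK// => /(congr1 (fun k => k%:R : R)).
rewrite !natrM => e.
have -> : 'C(n.-1, tau.-1)%:R = tau%:R * 'C(n, tau)%:R / n%:R :> R.
  by rewrite -e mulrAC mulfV// mul1r.
by field; rewrite n0 t0.
Qed.

End uniform_batches.

(** * The averaged one-step bound and its iteration *)

Lemma Lmax_gt0 (R : realType) n (L : 'I_n -> R) :
  (0 < n)%N -> (forall i, 0 < L i) -> 0 < Lmax L.
Proof.
by case: n L => // n L _ L0; apply: lt_le_trans (L0 ord0) (le_bigmax _ _ _).
Qed.

Lemma quad_bounded_Lmax (R : realType) (d n : nat) (f : 'I_n -> 'rV[R]_d -> R)
    (L : 'I_n -> R) : (forall i x, differentiable (f i) x) ->
  (forall i, convex (f i)) -> (forall i, 0 < L i) ->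
  (forall i, smooth (L i) (f i)) -> forall i, quad_bounded (Lmax L) (f i).
Proof.
move=> df cf L0 sf i x y; rewrite convex_first_order//=.
apply: le_trans (smooth_descent x y (L0 i) (df i) (sf i)) _.
rewrite lerD2l ler_wpM2r ?dot_ge0// ler_wpM2r//; exact: le_bigmax.
Qed.

Section one_step.
Context {R : realType} {d n : nat} (tau : nat) (htau : (1 <= tau <= n)%N).
Context (f : 'I_n -> 'rV[R]_d -> R) (L mu rho gammab : R) (xs : 'rV[R]_d).
Context (ell : {set 'I_n} -> R).
Hypotheses (L0 : 0 < L) (df : forall i x, differentiable (f i) x).
Hypothesis qf : forall i, quad_bounded L (f i).
Hypotheses (rho0 : 0 <= rho) (rhoL : L * rho <= 1) (gammab0 : 0 < gammab).
Hypothesis hell : forall S : {set 'I_n}, #|S| = tau ->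
  forall x, ell S <= batch tau f S x.
Hypothesis growth : forall x,
  mu / 2 * dot (x - xs) (x - xs) <= objective f x - objective f xs.

Let alpha := (1 - L * rho) ^+ 2 * Num.min (1 / (2 * L)) gammab.

Definition usam_step (A : {set 'I_n}) (x : 'rV[R]_d) :=
  let g := batch tau f A in
  x - polyak_step rho gammab g (ell A) x *: grad g (usam_point rho g x).

Lemma usam_sps_driven x0 (S : nat -> {set 'I_n}) t :
  usam_sps tau f ell rho gammab x0 S t = driven usam_step x0 S t.
Proof.
elim: t => [|t ih]; first by [].
by rewrite [LHS]/usam_sps -/usam_sps ih.
Qed.

Lemma alpha_ge0 : 0 <= alpha.
Proof. by rewrite mulr_ge0 ?sqr_ge0// le_min divr_ge0 ?ltW// mulr_gt0. Qed.

Lemma alpha_le : alpha <= Num.min (1 / (2 * L)) gammab.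
Proof.
rewrite ler_piMl//; first by rewrite le_min divr_ge0 ?ltW// mulr_gt0.
by rewrite expr_le1// ?subr_ge0// gerBl mulr_ge0// ltW.
Qed.

Lemma mean_usam_step x :
  \sum_A batch_law (R := R) tau A * l2norm (usam_step A x - xs) ^+ 2 <=
  (1 - mu * alpha / 2) * l2norm (x - xs) ^+ 2 +
  (2 * gammab - alpha) *
    \sum_A batch_law (R := R) tau A * (batch tau f A xs - ell A).
Proof.
have tau0 : (0 < tau)%N by case/andP: htau.
pose bound (A : {set 'I_n}) := l2norm (x - xs) ^+ 2
  - alpha * (batch tau f A x - batch tau f A xs)
  + (2 * gammab - alpha) * (batch tau f A xs - ell A).
apply: (@le_trans _ _ (\sum_A batch_law (R := R) tau A * bound A)).
  (* [hell] speaks only of sets of size [tau]; the others have weight 0. *)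
  apply: ler_sum => A _; have [cA|cA] := eqVneq #|A| tau; last first.
    by rewrite /batch_law (negbTE cA) !mul0r.
  rewrite ler_wpM2l ?batch_law_ge0//.
  exact: (usam_polyak_descent L0 (quad_bounded_batch tau0 cA df qf)
    xs x rho0 rhoL gammab0 (hell cA)).
have -> : \sum_A batch_law tau A * bound A =
    l2norm (x - xs) ^+ 2 * \sum_A batch_law (R := R) (n := n) tau A
    - alpha * \sum_A batch_law (R := R) tau A * batch tau f A x
    + alpha * \sum_A batch_law (R := R) tau A * batch tau f A xs
    + (2 * gammab - alpha) *
      \sum_A batch_law (R := R) tau A * (batch tau f A xs - ell A).
  rewrite -mulNr !mulr_sumr -!big_split/=; apply: eq_bigr => A _.
  by rewrite /bound; ring.
rewrite !mean_batch// sum_batch_law1// mulr1.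
have := ler_wpM2l alpha_ge0 (growth x); rewrite l2norm_sqr; lra.
Qed.

Lemma mean_batch_gap_ge0 :
  0 <= \sum_A batch_law (R := R) tau A * (batch tau f A xs - ell A).
Proof.
apply: sumr_ge0 => A _; have [cA|cA] := eqVneq #|A| tau.
  by rewrite mulr_ge0 ?batch_law_ge0// subr_ge0 hell.
by rewrite /batch_law (negbTE cA) mul0r.
Qed.

Lemma mean_usam_iterates x0 t : 0 < mu -> 0 < alpha ->
  driven_mean (batch_law tau) usam_step x0 t (fun x => l2norm (x - xs) ^+ 2) <=
  (1 - mu * alpha / 2) ^+ t * l2norm (x0 - xs) ^+ 2 +
  2 * (2 * gammab - alpha) / (mu * alpha) *
    \sum_A batch_law (R := R) tau A * (batch tau f A xs - ell A).
Proof.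
move=> mu0 al0.
have agb : alpha <= gammab by apply: le_trans alpha_le _; rewrite ge_min lexx orbT.
have aL : alpha * (2 * L) <= 1.
  rewrite -ler_pdivlMr ?mulr_gt0//; apply: le_trans alpha_le _.
  by rewrite ge_min lexx.
set c := (2 * gammab - alpha) * \sum_A batch_law tau A * (batch tau f A xs - ell A).
have c0 : 0 <= c by rewrite mulr_ge0 ?mean_batch_gap_ge0//; lra.
have ma0 : 0 < mu * alpha by rewrite mulr_gt0.
have -> : 2 * (2 * gammab - alpha) / (mu * alpha) *
    \sum_A batch_law (R := R) tau A * (batch tau f A xs - ell A) =
    c / (1 - (1 - mu * alpha / 2)).
  by rewrite /c; field; rewrite !gt_eqF//; lra.
have [q0|q0] := leP 0 (1 - mu * alpha / 2).
  apply: driven_mean_contract => //.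
  - exact: batch_law_ge0.
  - exact: sum_batch_law1.
  - by rewrite q0/=; lra.
  - exact: mean_usam_step.
(* A negative contraction factor means [mu alpha > 2]; with [2 L alpha <= 1] this gives [L < mu],
   and [growth_le_smooth] leaves [xs] as the only point of the space. *)
have D0 x : l2norm (x - xs) ^+ 2 = 0.
  rewrite l2norm_sqr; apply/eqP; rewrite eq_le dot_ge0 andbT.
  have qo : quad_bounded L (objective f).
    rewrite objective_batch; apply: quad_bounded_batch => //.
      by case/andP: htau => /leq_trans h /h.
    by rewrite cardsT card_ord.
  have := growth_le_smooth x qo growth; rewrite -subr_ge0 -mulrBl.
  have muL : L < mu by rewrite -(ltr_pM2r al0); lra.
  by rewrite nmulr_rge0 // subr_lt0.
(* Written as [0 * phi + 0], the zero function has mean 0 by [driven_mean_affine]. *)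
have -> : (fun x => l2norm (x - xs) ^+ 2) = (fun x => 0 * l2norm (x - xs) ^+ 2 + 0).
  by apply/funext => x; rewrite D0 mulr0 addr0.
rewrite driven_mean_affine ?sum_batch_law1// D0 !mulr0 mul0r !add0r.
by rewrite divr_ge0//; lra.
Qed.

End one_step.

Theorem theorem3p5 (R : realType) (d n tau : nat)
    (htau : (1 <= tau <= n)%N)
    (f : 'I_n -> 'rV[R]_d -> R) (L : 'I_n -> R)
    (hdiff : forall i x, differentiable (f i) x)
    (hlb : forall i, lower_bounded (f i))
    (hconv : forall i, convex (f i))
    (hL : forall i, 0 < L i)
    (hsmooth : forall i, smooth (L i) (f i))
    (mu : R) (hmu : 0 < mu)
    (hsc : strongly_convex mu (objective f))
    (xstar : 'rV[R]_d) (hxstar : minimizer (objective f) xstar)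
    (rho : R) (hrho : 0 <= rho <= 1 / Lmax L)
    (gammab : R) (hgammab : 0 < gammab)
    (ell : {set 'I_n} -> R)
    (hell : forall S : {set 'I_n}, #|S| = tau ->
       forall x, ell S <= batch tau f S x)
    (dsp : measure_display) (Omega : measurableType dsp)
    (P : probability Omega R)
    (S : nat -> Omega -> {set 'I_n})
    (hSmeas : forall t, batch_measurable (S t))
    (hSunif : forall t, uniform_batch P tau (S t))
    (hSind : batches_independent P S)
    (x0 : 'rV[R]_d) (t : nat) :
  let alpha : R :=
    (1 - Lmax L * rho) ^+ 2 * Num.min (1 / (2 * Lmax L)) gammab in
  let x : nat -> Omega -> 'rV[R]_d := fun s w =>
    usam_sps tau f ell rho gammab x0 (fun k => S k w) s in
  let sigma2 : \bar R :=
    ('E_P[(fun w => batch tau f (S t w) xstar - ell (S t w))%R])%E in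
  ('E_P[(fun w => l2norm (x t w - xstar) ^+ 2)%R] <=
   if alpha == 0%R then +oo else
     ((1 - mu * alpha / 2) ^+ t * l2norm (x0 - xstar) ^+ 2)%R%:E
     + (2 * (2 * gammab - alpha) / (mu * alpha))%R%:E * sigma2)%E.
Proof.
lazy zeta; set alpha := ((1 - Lmax L * rho) ^+ 2 * _)%R.
have [_|al0] := eqVneq alpha 0; first exact: leey.
have Lm0 : 0 < Lmax L by apply: Lmax_gt0 => //; case/andP: htau => /leq_trans h /h.
have /andP[rho0 rhoL] := hrho; rewrite ler_pdivlMr// mulrC in rhoL.
have qf := quad_bounded_Lmax hdiff hconv hL hsmooth.
have growth y := strongly_convex_growth y hsc hxstar.
have lawS s A : P (S s @^-1` [set A]%classic) = (batch_law tau A)%:E := hSunif s A.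
have -> : ('E_P[(fun w => batch tau f (S t w) xstar - ell (S t w))%R] =
    (\sum_A batch_law tau A * (batch tau f A xstar - ell A))%R%:E)%E.
  rewrite (expectation_finite P (hSmeas t)
    (fun A => batch tau f A xstar - ell A)) -sumEFin.
  by apply: eq_bigr => A _; rewrite lawS muleC.
have -> : (fun w =>
    l2norm (usam_sps tau f ell rho gammab x0 (S ^~ w) t - xstar) ^+ 2) = (fun w =>
    l2norm (driven (usam_step tau f rho gammab ell) x0 (S ^~ w) t - xstar) ^+ 2).
  by apply/funext => w; rewrite usam_sps_driven.
rewrite (expectation_driven hSmeas lawS hSind (usam_step tau f rho gammab ell) x0 t
  (fun y => l2norm (y - xstar) ^+ 2)) -EFinM -EFinD lee_fin.
apply: mean_usam_iterates => //.
by rewrite lt_neqAle eq_sym al0 alpha_ge0.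
Qed.
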